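(* For every integer $n\ge 1$ consider the dynamical system $x_0=0$, $\dot{x}_t=b_n(x_t)$, and let $T_n$ be the time at which it hits $\pi$. Then, as $n\to\infty$, $$T_n\sim\frac{\ln(n)}{n}.$$
   Context: The drift $b_n:(0,\pi)\to\mathbb{R}$ is given by $$b_n(x)=2\,\frac{\sin^n(x)}{\int_0^x\sin^n(u)\,du}-n\,\frac{\cos(x)}{\sin(x)},\qquad x\in(0,\pi).$$ It satisfies $b_n(x)\sim (n+2)/x$ as $x\to 0_+$; the solution started at $0$ is the continuous trajectory with $x_0=0$ and $x_t\in(0,\pi)$, $\dot{x}_t=b_n(x_t)$ for $t\in(0,T_n)$. The notation $u_n\sim v_n$ means $u_n/v_n\to 1$ as $n\to\infty$. *)

(* Defs.v *)
(* Stdlib reals with Coquelicot. *)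
From Stdlib Require Import Reals.
From Coquelicot Require Import Coquelicot.
Open Scope R_scope.

Definition drift (n : nat) (x : R) : R :=
  2 * (sin x ^ n / RInt (fun u : R => sin u ^ n) 0 x)
  - INR n * (cos x / sin x).

(* [drift n] is singular at 0 and PI, so the differential equation is only
   required on the open interval ]0, T[ and the endpoint values are attained by
   (one-sided) continuity; the values of [x] outside [0, T] are irrelevant.
   Since [x t < PI] for [t < T], the time [T] is the first hitting time. *)
Definition solution_hits_pi_at (n : nat) (x : R -> R) (T : R) : Prop :=
  0 < T /\
  continuous_on (fun t : R => 0 <= t <= T) x /\
  x 0 = 0 /\
  (forall t : R, 0 < t < T -> 0 < x t < PI) /\
  (forall t : R, 0 < t < T -> is_derive x t (drift n (x t))) /\
  x T = PI.

Definition is_hitting_time (n : nat) (T : R) : Prop :=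
  exists x : R -> R, solution_hits_pi_at n x T.

(* Meant for [v] eventually nonzero; finitely many indices are irrelevant. *)
Definition seq_equivalent (u v : nat -> R) : Prop :=
  is_lim_seq (fun n : nat => u n / v n) 1.

(* Main.v *)
Require Import Defs.
From Stdlib Require Import Reals Lra Lia Ranalysis5.
From Coquelicot Require Import Coquelicot.
Open Scope R_scope.

(** Write [I x] for the integral of [sin^n] over [0, x]. The drift is positive
    on ]0, PI[ and its reciprocal

      [h x = I x * sin x / (2 sin^(n+1) x - n * cos x * I x)]

    tends to 0 at both ends, so it extends to a continuous function on [0, PI].
    Along a solution, [F (x t) - t] is constant, where [F] is the primitive of
    [h] vanishing at 0. Hence the hitting time can only be [F PI]
    ([hitting_time_eq]), and the inverse function of [F] is a solution
    ([hitting_time_travel_time]).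

    The asymptotics of [F PI] come from three elementary bounds on [I], each
    obtained by comparing derivatives:
    - [(n+1) * cos x * I x <= sin^(n+1) x] on [0, PI/2[,
    - [sin^(n+1) x * cos x <= ((n+1) cos^2 x + sin^2 x) * I x] on [0, PI/2[,
    - [sin^(n-1) x * |cos x| <= I x] on [PI/2, PI].

    The last two give [h >= sin |cos| / ((n+2) cos^2 + 2 sin^2)] on the whole
    segment. The right-hand side has an explicit primitive, a logarithm, and
    [F PI >= ln ((n+2)/2) / n] follows ([travel_time_ge]).

    The first one gives [h <= sin / (n |cos|)] and [h <= I / sin^n]. For the upper
    bound ([travel_time_le]), the former is integrated
    at distance at least [e = 1 / sqrt n] from [PI/2], where it contributes
    [- 2 ln (sin e) / n = ln n / n + O(1/n)]. On the remaining window of width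
    [2 e], the latter is used: there [I = O(e)] and [sin^n] is
    at least [1/2], so the window contributes [O(e^2) = O(1/n)]. *)

(** * Elementary inequalities *)

(** Comparison of increments through comparison of derivatives. *)
Lemma increment_le (f g f' g' : R -> R) (a b : R) :
  a <= b ->
  (forall x, a <= x <= b -> is_derive f x (f' x)) ->
  (forall x, a <= x <= b -> is_derive g x (g' x)) ->
  (forall x, a <= x <= b -> f' x <= g' x) ->
  f b - f a <= g b - g a.
Proof.
  intros Hab Hf Hg Hle.
  assert (Hd : forall x, a <= x <= b ->
            is_derive (fun x => g x - f x) x (g' x - f' x)).
  { intros x Hx. apply (is_derive_minus g f x (g' x) (f' x)); auto. }
  destruct (MVT_gen (fun x => g x - f x) a b (fun x => g' x - f' x))
    as [c [Hc Heq]].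
  - rewrite Rmin_left, Rmax_right by lra. intros x Hx. apply Hd. lra.
  - rewrite Rmin_left, Rmax_right by lra. intros x Hx.
    apply continuity_pt_filterlim. apply (ex_derive_continuous (fun x => g x - f x)).
    eexists. apply Hd. lra.
  - rewrite Rmin_left, Rmax_right in Hc by lra.
    specialize (Hle c Hc).
    assert (0 <= (g' c - f' c) * (b - a)) by (apply Rmult_le_pos; lra).
    lra.
Qed.

Lemma Rdiv_le_cross (a b c d : R) :
  0 < b -> 0 < d -> a * d <= c * b -> a / b <= c / d.
Proof.
  intros Hb Hd H.
  apply (Rmult_le_reg_r (b * d)); [nra|].
  replace (a / b * (b * d)) with (a * d) by (field; lra).
  replace (c / d * (b * d)) with (c * b) by (field; lra). exact H.
Qed.

Lemma bernoulli_inequality (n : nat) (a : R) :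
  0 <= a <= 1 -> 1 - INR n * a <= (1 - a) ^ n.
Proof.
  intros Ha. induction n as [|n IH]; [simpl; lra|].
  rewrite S_INR. simpl.
  assert (H := pos_INR n).
  assert (0 <= INR n * (a * a)) by (apply Rmult_le_pos; nra).
  apply (Rmult_le_compat_l (1 - a)) in IH; lra.
Qed.

Lemma one_minus_half_sqr_le_cos (x : R) : 1 - x ^ 2 / 2 <= cos x.
Proof.
  replace x with (2 * (x / 2)) at 2 by field.
  rewrite cos_2a_sin.
  assert (H : Rabs (sin (x / 2)) <= Rabs (x / 2)).
  { destruct (Rtotal_order (x / 2) 0) as [Hn|[H0|Hp]].
    - assert (H := sin_lt_x (- (x / 2)) ltac:(lra)). rewrite sin_neg in H.
      assert (H2 := SIN_bound (x / 2)).
      destruct (Rle_dec (x / 2) (-1)) as [H1|H1].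
      + rewrite (Rabs_left (x / 2)) by lra.
        apply Rabs_le. lra.
      + assert (sin (x / 2) < 0).
        { assert (H3 := sin_gt_0 (- (x / 2)) ltac:(lra)).
          assert (H4 := PI2_1). rewrite sin_neg in H3. lra. }
        rewrite !Rabs_left by lra. lra.
    - rewrite H0, sin_0. lra.
    - assert (H := sin_lt_x (x / 2) ltac:(lra)).
      assert (H2 := SIN_bound (x / 2)).
      destruct (Rle_dec 1 (x / 2)) as [H1|H1].
      + rewrite (Rabs_right (x / 2)) by lra. apply Rabs_le. lra.
      + assert (0 < sin (x / 2)).
        { apply sin_gt_0; [lra|]. assert (H4 := PI2_1). lra. }
        rewrite !Rabs_right by lra. lra. }
  apply Rsqr_le_abs_1 in H. unfold Rsqr in H. nra.
Qed.

Lemma half_le_sin (x : R) : 0 <= x <= 1 -> x / 2 <= sin x.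
Proof.
  intros Hx.
  assert (H : x / 2 - 0 / 2 <= sin x - sin 0).
  { apply (increment_le (fun u => u / 2) sin (fun _ => 1 / 2) cos); [lra| | |].
    - intros u _. auto_derive; [exact I|]. field.
    - intros u _. apply is_derive_sin.
    - intros u Hu. assert (H := one_minus_half_sqr_le_cos u). nra. }
  rewrite sin_0 in H. lra.
Qed.

(** * Bounds on the integral of the powers of the sine *)

(** The integral [I] of [sin^n] from 0 that occurs in the drift. *)
Definition sin_power_integral (n : nat) (x : R) : R :=
  RInt (fun u : R => sin u ^ n) 0 x.

Lemma continuous_sin_pow (n : nat) (x : R) : continuous (fun u => sin u ^ n) x.
Proof.
  apply (ex_derive_continuous (fun u => sin u ^ n)). auto_derive. exact I.
Qed.

Lemma is_derive_sin_power_integral (n : nat) (x : R) :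
  is_derive (sin_power_integral n) x (sin x ^ n).
Proof.
  apply (is_derive_RInt (fun u => sin u ^ n) (sin_power_integral n) 0).
  - apply filter_forall. intros y.
    apply (RInt_correct (fun u => sin u ^ n)), (ex_RInt_continuous (fun u => sin u ^ n)).
    intros z _. apply continuous_sin_pow.
  - apply continuous_sin_pow.
Qed.

Lemma sin_power_integral_0 (n : nat) : sin_power_integral n 0 = 0.
Proof. apply (RInt_point 0 (fun u => sin u ^ n)). Qed.

Lemma sin_power_integral_pos (n : nat) (x : R) :
  0 < x <= PI -> 0 < sin_power_integral n x.
Proof.
  intros Hx. apply RInt_gt_0; [lra | | intros; apply continuous_sin_pow].
  intros y Hy. apply pow_lt, sin_gt_0; lra.
Qed.

(** The quotient [sin^(n+1) / cos] has derivative
    [(n+1) sin^n + sin^(n+2) / cos^2], which is at least [(n+1) sin^n]. *)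
Lemma sin_power_integral_upper (n : nat) (x : R) :
  0 <= x < PI / 2 ->
  (INR n + 1) * cos x * sin_power_integral n x <= sin x ^ (n + 1).
Proof.
  intros Hx.
  assert (Hc : forall u, 0 <= u <= x -> 0 < cos u)
    by (intros; apply cos_gt_0; lra).
  assert (H := increment_le
    (fun u => (INR n + 1) * sin_power_integral n u)
    (fun u => sin u ^ (n + 1) / cos u)
    (fun u => (INR n + 1) * sin u ^ n)
    (fun u => (INR n + 1) * sin u ^ n + sin u ^ (n + 2) / cos u ^ 2) 0 x).
  cbv beta in H. rewrite sin_power_integral_0, sin_0, pow_i in H by lia.
  replace (sin x ^ (n + 1)) with (sin x ^ (n + 1) / cos x * cos x)
    by (field; specialize (Hc x); lra).
  assert (HH : (INR n + 1) * sin_power_integral n x <= sin x ^ (n + 1) / cos x).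
  { cut ((INR n + 1) * sin_power_integral n x - (INR n + 1) * 0 <=
         sin x ^ (n + 1) / cos x - 0 / cos 0); [unfold Rdiv; lra|].
    apply H; [lra | | |].
    - intros u Hu. apply (is_derive_scal (sin_power_integral n) u (INR n + 1) (sin u ^ n)).
      apply is_derive_sin_power_integral.
    - intros u Hu. specialize (Hc u Hu).
      auto_derive; [lra|].
      replace (Init.Nat.pred (n + 1)) with n by lia.
      rewrite !pow_add, plus_INR. simpl. field. lra.
    - intros u Hu. specialize (Hc u Hu).
      assert (0 <= sin u) by (apply sin_ge_0; lra).
      assert (0 <= sin u ^ (n + 2) / cos u ^ 2); [|lra].
      apply Rmult_le_pos; [apply pow_le; lra|].
      left; apply Rinv_0_lt_compat, pow_lt; lra. }
  specialize (Hc x). apply (Rmult_le_compat_r (cos x)) in HH; lra.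
Qed.

(** The same derivative is [(n + 1 + tan^2) sin^n], and [tan^2] is at most its
    value at the right end of [0, x]. *)
Lemma sin_power_integral_lower_left (n : nat) (x : R) :
  0 <= x < PI / 2 ->
  sin x ^ (n + 1) * cos x <=
  ((INR n + 1) * cos x ^ 2 + sin x ^ 2) * sin_power_integral n x.
Proof.
  intros Hx.
  assert (Hc : forall u, 0 <= u <= x -> 0 < cos u)
    by (intros; apply cos_gt_0; lra).
  assert (HH : sin x ^ (n + 1) / cos x - sin 0 ^ (n + 1) / cos 0 <=
    (INR n + 1 + tan x ^ 2) * sin_power_integral n x
    - (INR n + 1 + tan x ^ 2) * sin_power_integral n 0).
  { apply (increment_le
      (fun u => sin u ^ (n + 1) / cos u)
      (fun u => (INR n + 1 + tan x ^ 2) * sin_power_integral n u)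
      (fun u => (INR n + 1 + tan u ^ 2) * sin u ^ n)
      (fun u => (INR n + 1 + tan x ^ 2) * sin u ^ n)); [lra | | |].
    - intros u Hu. specialize (Hc u Hu). unfold tan.
      auto_derive; [lra|].
      replace (Init.Nat.pred (n + 1)) with n by lia.
      rewrite !pow_add, plus_INR. simpl. field. lra.
    - intros u Hu.
      apply (is_derive_scal (sin_power_integral n) u _ (sin u ^ n)).
      apply is_derive_sin_power_integral.
    - intros u Hu.
      apply Rmult_le_compat_r; [apply pow_le, sin_ge_0; lra|].
      apply Rplus_le_compat_l, pow_incr.
      assert (Hcu := Hc u Hu).
      split.
      + unfold tan. apply Rmult_le_pos; [apply sin_ge_0; lra|].
        left; apply Rinv_0_lt_compat; lra.
      + destruct (Req_dec u x) as [->|Hne]; [lra|].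
        left; apply tan_increasing; lra. }
  specialize (Hc x ltac:(lra)).
  rewrite sin_power_integral_0, sin_0, pow_i in HH by lia.
  apply (Rmult_le_compat_r (cos x ^ 2)) in HH; [|nra].
  unfold tan in HH.
  replace ((sin x ^ (n + 1) / cos x - 0 / cos 0) * cos x ^ 2)
    with (sin x ^ (n + 1) * cos x) in HH
    by (unfold Rdiv; rewrite Rmult_0_l; field; lra).
  eapply Rle_trans; [exact HH|]. right. field. lra.
Qed.

(** The derivative of [- sin^m * cos] is at most [sin^(m+1)], and the function
    vanishes at [PI/2], where the integral is already positive. *)
Lemma sin_power_integral_lower_right (m : nat) (x : R) :
  PI / 2 <= x <= PI ->
  sin x ^ m * - cos x <= sin_power_integral (S m) x.
Proof.
  intros Hx.
  assert (HH : sin x ^ m * - cos x - sin (PI / 2) ^ m * - cos (PI / 2) <=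
    sin_power_integral (S m) x - sin_power_integral (S m) (PI / 2)).
  { apply (increment_le
      (fun u => sin u ^ m * - cos u) (sin_power_integral (S m))
      (fun u => sin u ^ S m - INR m * (cos u ^ 2 * sin u ^ pred m))
      (fun u => sin u ^ S m)); [lra | | |].
    - intros u Hu. auto_derive; [exact I|]. simpl. ring.
    - intros u Hu. apply is_derive_sin_power_integral.
    - intros u Hu.
      assert (0 <= INR m * (cos u ^ 2 * sin u ^ pred m)); [|lra].
      apply Rmult_le_pos; [apply pos_INR|].
      apply Rmult_le_pos; [apply pow2_ge_0|].
      apply pow_le, sin_ge_0; lra. }
  rewrite cos_PI2 in HH.
  assert (H := sin_power_integral_pos (S m) (PI / 2)).
  assert (HP := PI_RGT_0).
  specialize (H ltac:(lra)). lra.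
Qed.

(** * The reciprocal of the drift *)

Definition slowness_denominator (n : nat) (x : R) : R :=
  2 * sin x ^ (n + 1) - INR n * cos x * sin_power_integral n x.

(** The reciprocal of the drift ([drift_mul_slowness]), with the inner fractions
    cleared so that its values at 0 and [PI] are 0. At 0 the quotient
    evaluates to [0 / 0 = 0], which is also the limit. *)
Definition slowness (n : nat) (x : R) : R :=
  sin_power_integral n x * sin x / slowness_denominator n x.

Lemma slowness_denominator_ge (n : nat) (x : R) :
  0 < x <= PI -> sin x ^ (n + 1) <= slowness_denominator n x.
Proof.
  intros Hx. unfold slowness_denominator.
  assert (HI := sin_power_integral_pos n x Hx).
  assert (Hn := pos_INR n).
  assert (Hs : 0 <= sin x ^ (n + 1)) by (apply pow_le, sin_ge_0; lra).
  destruct (Rlt_le_dec x (PI / 2)) as [Hlt|Hge].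
  - assert (H := sin_power_integral_upper n x ltac:(lra)).
    assert (0 < cos x) by (apply cos_gt_0; lra).
    assert (0 < cos x * sin_power_integral n x) by (apply Rmult_lt_0_compat; lra).
    lra.
  - assert (cos x <= 0) by (apply cos_le_0; lra).
    assert (0 <= INR n * (- cos x * sin_power_integral n x)).
    { apply Rmult_le_pos; [lra|]. apply Rmult_le_pos; lra. }
    lra.
Qed.

Lemma slowness_denominator_pos (n : nat) (x : R) :
  (1 <= n)%nat -> 0 < x <= PI -> 0 < slowness_denominator n x.
Proof.
  intros Hn Hx. destruct (Req_dec x PI) as [->|Hne].
  - unfold slowness_denominator. rewrite sin_PI, cos_PI, pow_i by lia.
    assert (H := sin_power_integral_pos n PI Hx).
    assert (0 < INR n) by (apply lt_0_INR; lia).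
    assert (0 < INR n * sin_power_integral n PI) by (apply Rmult_lt_0_compat; lra).
    lra.
  - eapply Rlt_le_trans; [|apply slowness_denominator_ge; lra].
    apply pow_lt, sin_gt_0; lra.
Qed.

Lemma drift_mul_slowness (n : nat) (x : R) :
  (1 <= n)%nat -> 0 < x < PI -> drift n x * slowness n x = 1.
Proof.
  intros Hn Hx.
  assert (HD := slowness_denominator_pos n x Hn ltac:(lra)).
  assert (HI := sin_power_integral_pos n x ltac:(lra)).
  assert (Hs : 0 < sin x) by (apply sin_gt_0; lra).
  unfold drift. fold (sin_power_integral n x).
  unfold slowness. unfold slowness_denominator in *.
  rewrite pow_add, pow_1 in *. field. lra.
Qed.

Lemma slowness_pos (n : nat) (x : R) :
  (1 <= n)%nat -> 0 < x < PI -> 0 < slowness n x.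
Proof.
  intros Hn Hx. apply Rdiv_lt_0_compat.
  - apply Rmult_lt_0_compat; [apply sin_power_integral_pos; lra|].
    apply sin_gt_0; lra.
  - apply slowness_denominator_pos; [assumption|lra].
Qed.

Lemma slowness_0 (n : nat) : slowness n 0 = 0.
Proof. unfold slowness. rewrite sin_0. unfold Rdiv. ring. Qed.

Lemma slowness_PI (n : nat) : slowness n PI = 0.
Proof. unfold slowness. rewrite sin_PI. unfold Rdiv. ring. Qed.

Lemma slowness_nonneg (n : nat) (x : R) :
  (1 <= n)%nat -> 0 <= x <= PI -> 0 <= slowness n x.
Proof.
  intros Hn Hx.
  destruct (Req_dec x 0) as [->|H0]; [rewrite slowness_0; lra|].
  destruct (Req_dec x PI) as [->|HP]; [rewrite slowness_PI; lra|].
  left; apply slowness_pos; [assumption|lra].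
Qed.

Lemma slowness_le_left (n : nat) (x : R) :
  (1 <= n)%nat -> 0 <= x < PI / 2 -> slowness n x <= sin x / (INR n * cos x).
Proof.
  intros Hn Hx.
  assert (Hn' : 0 < INR n) by (apply lt_0_INR; lia).
  assert (Hc : 0 < cos x) by (apply cos_gt_0; lra).
  assert (Hs : 0 <= sin x) by (apply sin_ge_0; lra).
  destruct (Req_dec x 0) as [->|Hne].
  { rewrite slowness_0, sin_0. lra. }
  assert (HI := sin_power_integral_pos n x ltac:(lra)).
  assert (H := sin_power_integral_upper n x Hx).
  assert (0 < cos x * sin_power_integral n x) by (apply Rmult_lt_0_compat; lra).
  apply Rdiv_le_cross.
  - apply slowness_denominator_pos; [assumption|lra].
  - apply Rmult_lt_0_compat; lra.
  - rewrite (Rmult_comm _ (sin x)), Rmult_assoc.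
    apply Rmult_le_compat_l; [exact Hs|]. unfold slowness_denominator. lra.
Qed.

Lemma slowness_le_right (n : nat) (x : R) :
  (1 <= n)%nat -> PI / 2 < x <= PI -> slowness n x <= sin x / (INR n * - cos x).
Proof.
  intros Hn Hx.
  assert (Hn' : 0 < INR n) by (apply lt_0_INR; lia).
  assert (Hc : cos x < 0) by (apply cos_lt_0; lra).
  assert (Hs : 0 <= sin x) by (apply sin_ge_0; lra).
  apply Rdiv_le_cross.
  - apply slowness_denominator_pos; [assumption|lra].
  - apply Rmult_lt_0_compat; lra.
  - rewrite (Rmult_comm _ (sin x)), Rmult_assoc.
    apply Rmult_le_compat_l; [exact Hs|]. unfold slowness_denominator.
    assert (0 <= sin x ^ (n + 1)) by (apply pow_le; exact Hs). lra.
Qed.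

Lemma slowness_le_quotient (n : nat) (x : R) :
  (1 <= n)%nat -> 0 < x < PI ->
  slowness n x <= sin_power_integral n x / sin x ^ n.
Proof.
  intros Hn Hx.
  assert (Hs : 0 < sin x) by (apply sin_gt_0; lra).
  assert (HI := sin_power_integral_pos n x ltac:(lra)).
  apply Rdiv_le_cross.
  - apply slowness_denominator_pos; [assumption|lra].
  - apply pow_lt; exact Hs.
  - rewrite Rmult_assoc. apply Rmult_le_compat_l; [lra|].
    change (sin x * sin x ^ n) with (sin x ^ S n).
    replace (S n) with (n + 1)%nat by lia.
    apply slowness_denominator_ge; lra.
Qed.

(** On ]0, PI[ away from [PI/2], this amounts to
    [drift n x <= (n + 2) |cot x| + 2 |tan x|]. *)
Lemma slowness_ge (n : nat) (x : R) :
  (1 <= n)%nat -> 0 <= x <= PI ->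
  sin x * Rabs (cos x) / ((INR n + 2) * cos x ^ 2 + 2 * sin x ^ 2) <= slowness n x.
Proof.
  intros Hn Hx.
  destruct (Req_dec x 0) as [->|Hne].
  { rewrite slowness_0, sin_0. unfold Rdiv. lra. }
  assert (Hn' := pos_INR n).
  assert (Hs : 0 <= sin x) by (apply sin_ge_0; lra).
  assert (HI := sin_power_integral_pos n x ltac:(lra)).
  assert (Hcs : sin x ^ 2 + cos x ^ 2 = 1).
  { assert (H := sin2_cos2 x). unfold Rsqr in H. lra. }
  assert (0 <= INR n * cos x ^ 2)
    by (apply Rmult_le_pos; [lra|apply pow2_ge_0]).
  apply Rdiv_le_cross.
  - lra.
  - apply slowness_denominator_pos; [assumption|lra].
  - rewrite (Rmult_comm (sin_power_integral n x)), !Rmult_assoc.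
    apply Rmult_le_compat_l; [exact Hs|]. unfold slowness_denominator.
    destruct (Rlt_le_dec x (PI / 2)) as [Hlt|Hge].
    + rewrite Rabs_pos_eq by (apply cos_ge_0; lra).
      assert (H1 := sin_power_integral_lower_left n x ltac:(lra)).
      lra.
    + rewrite Rabs_left1 by (apply cos_le_0; lra).
      destruct n as [|m]; [lia|].
      assert (H1 := sin_power_integral_lower_right m x ltac:(lra)).
      apply (Rmult_le_compat_l (sin x ^ 2)) in H1; [|apply pow2_ge_0].
      replace (sin x ^ (S m + 1)) with (sin x ^ 2 * sin x ^ m)
        by (rewrite pow_add; simpl; ring).
      assert (0 <= sin_power_integral (S m) x * cos x ^ 2)
        by (apply Rmult_le_pos; [lra|apply pow2_ge_0]).
      lra.
Qed.

(** * The travel time *)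

(** The projection of the line onto the segment with end points [a <= b]. *)
Definition clamp (a b x : R) : R := Rmax a (Rmin b x).

Lemma clamp_in (a b x : R) : a <= b -> a <= clamp a b x <= b.
Proof. unfold clamp, Rmax, Rmin. intros. repeat destruct Rle_dec; lra. Qed.

Lemma clamp_id (a b x : R) : a <= x <= b -> clamp a b x = x.
Proof. unfold clamp, Rmax, Rmin. intros. repeat destruct Rle_dec; lra. Qed.

Lemma clamp_lipschitz (a b x y : R) :
  Rabs (clamp a b y - clamp a b x) <= Rabs (y - x).
Proof.
  unfold clamp, Rmax, Rmin, Rabs. intros.
  repeat destruct Rle_dec; repeat destruct Rcase_abs; lra.
Qed.

Lemma continuous_clamp (a b x : R) : continuous (clamp a b) x.
Proof.
  apply filterlim_locally. intros eps. exists eps. intros y Hy.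
  eapply Rle_lt_trans; [apply clamp_lipschitz|exact Hy].
Qed.

(** Continuity relative to a segment becomes continuity on the whole line after
    extension by the end values. *)
Lemma continuous_comp_clamp (a b : R) (x : R -> R) (t : R) :
  a <= b -> continuous_on (fun s => a <= s <= b) x ->
  continuous (fun s => x (clamp a b s)) t.
Proof.
  intros Hab Hx.
  eapply filterlim_comp; [|apply (Hx (clamp a b t)), clamp_in, Hab].
  intros P HP. unfold within in HP.
  generalize (continuous_clamp a b t _ HP). unfold filtermap.
  apply filter_imp. intros s Hs. apply Hs, clamp_in, Hab.
Qed.

(** Extension of [slowness n] by 0 to a function continuous on the whole line. *)
Definition slowness_ext (n : nat) (x : R) : R := slowness n (clamp 0 PI x).

Lemma slowness_ext_eq (n : nat) (x : R) :
  0 <= x <= PI -> slowness_ext n x = slowness n x.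
Proof. intros. unfold slowness_ext. now rewrite clamp_id. Qed.

Lemma slowness_le_linear (n : nat) (x : R) :
  (1 <= n)%nat -> 0 <= x <= 1 -> slowness n x <= 2 * x.
Proof.
  intros Hn Hx. assert (HP := PI2_1).
  destruct (Req_dec x 0) as [->|H0]; [rewrite slowness_0; lra|].
  eapply Rle_trans; [apply slowness_le_left; [assumption|lra]|].
  assert (Hc := one_minus_half_sqr_le_cos x).
  assert (Hs := sin_lt_x x ltac:(lra)).
  assert (1 <= INR n) by (apply (le_INR 1); exact Hn).
  assert (Hc2 : 1 / 2 <= cos x) by nra.
  assert (1 / 2 <= INR n * cos x) by nra.
  replace (2 * x) with (x / (1 / 2)) by field.
  apply Rdiv_le_cross; [lra|lra|nra].
Qed.

Lemma continuous_slowness (n : nat) (x : R) :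
  (1 <= n)%nat -> 0 < x <= PI -> continuous (slowness n) x.
Proof.
  intros Hn Hx. assert (HD := slowness_denominator_pos n x Hn Hx).
  apply (ex_derive_continuous (slowness n)).
  assert (HI : ex_derive (sin_power_integral n) x)
    by (eexists; apply is_derive_sin_power_integral).
  unfold slowness, slowness_denominator in *. auto_derive.
  repeat split; try exact HI; try (intros; lra).
Qed.

Lemma continuous_slowness_ext (n : nat) (x : R) :
  (1 <= n)%nat -> continuous (slowness_ext n) x.
Proof.
  intros Hn. assert (HP := PI2_1).
  destruct (Rlt_le_dec 0 x) as [Hx|Hx].
  - apply (continuous_comp (clamp 0 PI) (slowness n)).
    + apply continuous_clamp.
    + apply continuous_slowness; [assumption|].
      unfold clamp, Rmax, Rmin. repeat destruct Rle_dec; lra.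
  (* At 0 the denominator vanishes too; [slowness_le_linear] replaces the
     continuity of the quotient. *)
  - apply filterlim_locally. intros eps.
    assert (Hd : 0 < Rmin 1 (eps / 2)).
    { apply Rmin_pos; [lra|]. assert (H := cond_pos eps). lra. }
    exists (mkposreal _ Hd). intros y Hy.
    change (Rabs (y - x) < Rmin 1 (eps / 2)) in Hy.
    change (Rabs (slowness_ext n y - slowness_ext n x) < eps).
    assert (Hc := clamp_lipschitz 0 PI x y).
    assert (Hin := clamp_in 0 PI y ltac:(lra)).
    unfold slowness_ext.
    assert (Hx0 : clamp 0 PI x = 0)
      by (unfold clamp, Rmax, Rmin; repeat destruct Rle_dec; lra).
    rewrite Hx0 in *. rewrite slowness_0, Rminus_0_r in *.
    rewrite Rabs_pos_eq in Hc by lra.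
    assert (H1 := Rmin_l 1 (eps / 2)). assert (H2 := Rmin_r 1 (eps / 2)).
    rewrite Rabs_pos_eq by (apply slowness_nonneg; auto).
    assert (H3 := slowness_le_linear n (clamp 0 PI y) Hn ltac:(lra)). lra.
Qed.

(** For [x] in [0, PI], the time needed to go from 0 to [x]: the integral of the
    reciprocal of the drift. *)
Definition travel_time (n : nat) (x : R) : R := RInt (slowness_ext n) 0 x.

Lemma is_derive_travel_time (n : nat) (x : R) :
  (1 <= n)%nat -> is_derive (travel_time n) x (slowness_ext n x).
Proof.
  intros Hn. apply (is_derive_RInt (slowness_ext n) (travel_time n) 0).
  - apply filter_forall. intros y.
    apply (RInt_correct (slowness_ext n)), (ex_RInt_continuous (slowness_ext n)).
    intros z _. now apply continuous_slowness_ext.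
  - now apply continuous_slowness_ext.
Qed.

Lemma travel_time_0 (n : nat) : travel_time n 0 = 0.
Proof. apply (RInt_point 0 (slowness_ext n)). Qed.

Lemma travel_time_incr (n : nat) (x y : R) :
  (1 <= n)%nat -> 0 <= x < y -> y <= PI -> travel_time n x < travel_time n y.
Proof.
  intros Hn Hx Hy.
  assert (H : RInt (slowness_ext n) 0 x + RInt (slowness_ext n) x y
              = RInt (slowness_ext n) 0 y).
  { apply (RInt_Chasles (slowness_ext n));
    apply (ex_RInt_continuous (slowness_ext n)); intros;
      now apply continuous_slowness_ext. }
  assert (0 < RInt (slowness_ext n) x y).
  { apply RInt_gt_0; [lra| |intros; now apply continuous_slowness_ext].
    intros z Hz. rewrite slowness_ext_eq by lra.
    apply slowness_pos; [assumption|lra]. }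
  unfold travel_time. lra.
Qed.

Lemma continuity_travel_time (n : nat) :
  (1 <= n)%nat -> continuity (travel_time n).
Proof.
  intros Hn x. apply continuity_pt_filterlim.
  apply (ex_derive_continuous (travel_time n)).
  eexists. now apply is_derive_travel_time.
Qed.

(** * Existence and uniqueness of the hitting time *)

(** The function [t |-> travel_time n (x t) - t] is continuous on [0, T]
    with derivative 0 inside. The clamp makes it continuous on both sides at the endpoints. *)
Lemma hitting_time_eq (n : nat) (T : R) :
  (1 <= n)%nat -> is_hitting_time n T -> T = travel_time n PI.
Proof.
  intros Hn [x (HT & Hcont & Hx0 & Hin & Hder & HxT)].
  set (g := fun t => travel_time n (x (clamp 0 T t)) - t).
  assert (Hg0 : g 0 = 0).
  { unfold g. rewrite clamp_id by lra. rewrite Hx0, travel_time_0. ring. }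
  assert (HgT : g T = travel_time n PI - T).
  { unfold g. rewrite clamp_id by lra. now rewrite HxT. }
  destruct (MVT_gen g 0 T (fun _ => 0)) as [c [_ Hc]].
  - rewrite Rmin_left, Rmax_right by lra. intros t Ht.
    apply (is_derive_ext_loc (fun s => travel_time n (x s) - s)).
    { apply (locally_interval _ t 0 T); simpl; try lra.
      intros s Hs1 Hs2. unfold g. now rewrite clamp_id by (simpl in *; lra). }
    assert (Hxt := Hin t Ht).
    replace 0 with (drift n (x t) * slowness_ext n (x t) - 1).
    2:{ rewrite slowness_ext_eq by lra.
        rewrite drift_mul_slowness by assumption. ring. }
    apply (is_derive_minus (fun s => travel_time n (x s)) (fun s => s)).
    + apply (is_derive_comp (travel_time n) x).
      * now apply is_derive_travel_time.
      * now apply Hder.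
    + apply (is_derive_id t).
  - intros t _. apply continuity_pt_filterlim.
    apply (continuous_minus (fun s => travel_time n (x (clamp 0 T s))) (fun s => s)).
    + apply (continuous_comp (fun s => x (clamp 0 T s)) (travel_time n)).
      * apply continuous_comp_clamp; [lra|exact Hcont].
      * apply continuity_pt_filterlim, continuity_travel_time, Hn.
    + apply continuous_id.
  - rewrite Hg0, HgT in Hc. lra.
Qed.

Lemma strict_mono_reflect (G : R -> R) :
  (forall u v, u < v -> G u < G v) -> forall u v, G u < G v -> u < v.
Proof.
  intros Hincr u v Huv. destruct (Rtotal_order u v) as [H|[H|H]]; [exact H| |].
  - subst; lra.
  - specialize (Hincr v u H). lra.
Qed.

Lemma continuous_right_inverse (G y : R -> R) :
  (forall u v, u < v -> G u < G v) -> (forall t, G (y t) = t) ->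
  forall t, continuous y t.
Proof.
  intros Hincr Hinv t. apply filterlim_locally. intros eps.
  assert (Heps := cond_pos eps).
  assert (H1 := Hincr (y t - eps) (y t) ltac:(lra)).
  assert (H2 := Hincr (y t) (y t + eps) ltac:(lra)).
  apply (locally_interval _ t (G (y t - eps)) (G (y t + eps)));
    simpl; try (rewrite Hinv in *; lra).
  intros s Hs1 Hs2. change (Rabs (y s - y t) < eps).
  rewrite <- (Hinv s) in Hs1, Hs2. simpl in *.
  assert (Hmon := strict_mono_reflect G Hincr).
  apply Hmon in Hs1, Hs2. apply Rabs_lt_between. lra.
Qed.

(** Here [y] need only invert [F] over the interval ]a, b[. *)
Lemma is_derive_right_inverse (F y : R -> R) (a b t l : R) :
  a < t < b -> (forall u, ex_derive F u) ->
  (forall s, a < s < b -> F (y s) = s) ->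
  (forall u v, a < u < v -> v < b -> y u < y v) ->
  continuous y t -> is_derive F (y t) l -> l <> 0 ->
  is_derive y t (/ l).
Proof.
  intros Ht HF Hinv Hincr Hcont Hl Hl0.
  set (lb := (a + t) / 2). set (ub := (t + b) / 2).
  assert (Hlb : a < lb < t) by (unfold lb; lra).
  assert (Hub : t < ub < b) by (unfold ub; lra).
  set (Prf := fun u (_ : y lb <= u <= y ub) => ex_derive_Reals_0 F u (HF u)).
  assert (Hin : y lb <= y t <= y ub) by (split; left; apply Hincr; lra).
  assert (Hval : derive_pt F (y t) (Prf (y t) Hin) = l).
  { rewrite Derive_Reals. now apply is_derive_unique. }
  apply is_derive_Reals.
  replace (/ l) with (1 / derive_pt F (y t) (Prf (y t) Hin)).
  2:{ rewrite Hval. unfold Rdiv. ring. }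
  apply (derivable_pt_lim_recip_interv F y lb ub t Prf).
  - now apply continuity_pt_filterlim.
  - lra.
  - lra.
  - intros s Hs. apply (Hinv s). lra.
  - now rewrite Hval.
Qed.

(** The solution is the inverse of [travel_time n]. *)
Lemma hitting_time_travel_time (n : nat) :
  (1 <= n)%nat -> is_hitting_time n (travel_time n PI).
Proof.
  intros Hn. assert (HP := PI_RGT_0).
  set (T := travel_time n PI).
  assert (HT : 0 < T).
  { unfold T. rewrite <- (travel_time_0 n). apply travel_time_incr; auto; lra. }
  (* [G] extends [travel_time n] from [0, PI] by affine pieces of slope 1 to an
     increasing bijection of the line, so that its inverse is continuous on the
     whole line, the times 0 and [T] included. *)
  set (G := fun u => travel_time n (clamp 0 PI u) + (u - clamp 0 PI u)).
  assert (HGeq : forall u, 0 <= u <= PI -> G u = travel_time n u).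
  { intros u Hu. unfold G. rewrite clamp_id by lra. ring. }
  assert (HGneg : forall u, u <= 0 -> G u = u).
  { intros u Hu. unfold G. replace (clamp 0 PI u) with 0.
    - rewrite travel_time_0. ring.
    - unfold clamp, Rmax, Rmin; repeat destruct Rle_dec; lra. }
  assert (HGbig : forall u, PI <= u -> G u = T + (u - PI)).
  { intros u Hu. unfold G. replace (clamp 0 PI u) with PI; [reflexivity|].
    unfold clamp, Rmax, Rmin; repeat destruct Rle_dec; lra. }
  assert (HGincr : forall u v, u < v -> G u < G v).
  { intros u v Huv. unfold G.
    assert (Hu := clamp_in 0 PI u ltac:(lra)).
    assert (Hv := clamp_in 0 PI v ltac:(lra)).
    (* As [clamp] is 1-Lipschitz, [u - clamp 0 PI u] is nondecreasing. *)
    destruct (Rlt_le_dec (clamp 0 PI u) (clamp 0 PI v)) as [H|H].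
    - assert (H1 := travel_time_incr n _ _ Hn (conj (proj1 Hu) H) (proj2 Hv)).
      assert (H2 := clamp_lipschitz 0 PI u v).
      rewrite !Rabs_pos_eq in H2 by lra. lra.
    - assert (H1 : clamp 0 PI u = clamp 0 PI v).
      { revert H. unfold clamp, Rmax, Rmin. repeat destruct Rle_dec; lra. }
      rewrite H1. lra. }
  assert (HGcont : continuity G).
  { intros u. apply continuity_pt_filterlim.
    apply (continuous_plus (fun u => travel_time n (clamp 0 PI u))
             (fun u => u - clamp 0 PI u)).
    - apply (continuous_comp (clamp 0 PI) (travel_time n));
        [apply continuous_clamp|].
      apply continuity_pt_filterlim, continuity_travel_time, Hn.
    - apply (continuous_minus (fun u => u) (clamp 0 PI));
        [apply continuous_id|apply continuous_clamp]. }
  assert (Hsurj : forall t, {u | G u = t}).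
  { intros t. destruct (IVT_gen G (- Rabs t) (PI + Rabs t) t HGcont)
      as [u [_ Hu]]; [|now exists u].
    assert (Ha := Rabs_pos t). assert (Hb := Rle_abs t).
    assert (Hc := Rle_abs (- t)). rewrite Rabs_Ropp in Hc.
    rewrite HGneg, HGbig by lra.
    rewrite Rmin_left, Rmax_right by lra. lra. }
  set (y := fun t => proj1_sig (Hsurj t)).
  assert (Hinv : forall t, G (y t) = t)
    by (intros t; exact (proj2_sig (Hsurj t))).
  assert (Hycont := continuous_right_inverse G y HGincr Hinv).
  assert (Hmon := strict_mono_reflect G HGincr).
  assert (Hinj : forall u v, G u = G v -> u = v).
  { intros u v Huv. destruct (Rtotal_order u v) as [H|[H|H]]; [|exact H|];
      apply HGincr in H; lra. }
  assert (HG0 : G 0 = 0) by (apply HGneg; lra).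
  assert (HGPI : G PI = T) by (apply HGeq; lra).
  assert (Hyin : forall t, 0 < t < T -> 0 < y t < PI).
  { intros t Ht. split; apply Hmon; rewrite Hinv; lra. }
  exists y. unfold solution_hits_pi_at.
  refine (conj HT (conj _ (conj _ (conj Hyin (conj _ _))))).
  - intros t _. eapply filterlim_filter_le_1; [|apply Hycont].
    intros P HPt. unfold within. revert HPt. apply filter_imp. auto.
  - apply Hinj. now rewrite Hinv.
  - intros t Ht. assert (Hyt := Hyin t Ht).
    assert (Hs := slowness_pos n (y t) Hn Hyt).
    assert (Hd := drift_mul_slowness n (y t) Hn Hyt).
    replace (drift n (y t)) with (/ slowness_ext n (y t)).
    2:{ rewrite slowness_ext_eq by lra.
        apply (Rmult_eq_reg_r (slowness n (y t))); [|lra].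
        rewrite Hd. field. lra. }
    apply (is_derive_right_inverse (travel_time n) y 0 T t).
    + exact Ht.
    + intros u. eexists. now apply is_derive_travel_time.
    + intros s Hs'. assert (Hys := Hyin s Hs').
      rewrite <- HGeq by lra. apply Hinv.
    + intros u v Hu Hv. apply Hmon. rewrite !Hinv. lra.
    + apply Hycont.
    + now apply is_derive_travel_time.
    + rewrite slowness_ext_eq by lra. lra.
  - apply Hinj. now rewrite Hinv.
Qed.

(** * Asymptotics of the hitting time *)

(** The minorant [sin |cos| / q] of the reciprocal of the drift, where
    [q = (n+2) cos^2 + 2 sin^2], has primitive [- ln q / (2n)] left of [PI/2] and
    [ln q / (2n)] right of it; [q] is [n + 2] at 0 and [PI], and 2 at [PI/2]. *)
Lemma travel_time_ge (n : nat) :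
  (1 <= n)%nat -> ln ((INR n + 2) / 2) / INR n <= travel_time n PI.
Proof.
  intros Hn. assert (HP := PI_RGT_0).
  assert (Hn1 : 1 <= INR n) by (apply (le_INR 1); exact Hn).
  set (q := fun x => (INR n + 2) * cos x ^ 2 + 2 * sin x ^ 2).
  assert (Hq : forall x, 0 < q x).
  { intros x. unfold q. assert (H := sin2_cos2 x). unfold Rsqr in H.
    assert (0 <= INR n * cos x ^ 2)
      by (apply Rmult_le_pos; [lra|apply pow2_ge_0]). lra. }
  assert (Hd : forall x, is_derive (fun x => ln (q x)) x
                           (- (2 * INR n) * (sin x * cos x / q x))).
  { intros x. specialize (Hq x). unfold q in *. auto_derive; [simpl in *; lra|].
    field. simpl in *; lra. }
  assert (Hleft : - / (2 * INR n) * ln (q (PI / 2)) - - / (2 * INR n) * ln (q 0)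
                  <= travel_time n (PI / 2) - travel_time n 0).
  { apply (increment_le (fun x => - / (2 * INR n) * ln (q x)) (travel_time n)
      (fun x => - / (2 * INR n) * (- (2 * INR n) * (sin x * cos x / q x)))
      (slowness_ext n)); [lra| | |].
    - intros x _. apply (is_derive_scal (fun x => ln (q x))). apply Hd.
    - intros x _. now apply is_derive_travel_time.
    - intros x Hx. rewrite slowness_ext_eq by lra.
      assert (H := slowness_ge n x Hn ltac:(lra)).
      rewrite Rabs_pos_eq in H by (apply cos_ge_0; lra).
      specialize (Hq x). fold (q x) in H.
      eapply Rle_trans; [|exact H]. right. field. lra. }
  assert (Hright : / (2 * INR n) * ln (q PI) - / (2 * INR n) * ln (q (PI / 2))
                  <= travel_time n PI - travel_time n (PI / 2)).
  { apply (increment_le (fun x => / (2 * INR n) * ln (q x)) (travel_time n)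
      (fun x => / (2 * INR n) * (- (2 * INR n) * (sin x * cos x / q x)))
      (slowness_ext n)); [lra| | |].
    - intros x _. apply (is_derive_scal (fun x => ln (q x))). apply Hd.
    - intros x _. now apply is_derive_travel_time.
    - intros x Hx. rewrite slowness_ext_eq by lra.
      assert (H := slowness_ge n x Hn ltac:(lra)).
      rewrite Rabs_left1 in H by (apply cos_le_0; lra).
      specialize (Hq x). fold (q x) in H.
      eapply Rle_trans; [|exact H]. right. field. lra. }
  unfold q in Hleft, Hright.
  rewrite cos_0, sin_0, cos_PI2, sin_PI2 in Hleft.
  rewrite cos_PI, sin_PI, cos_PI2, sin_PI2 in Hright.
  replace ((INR n + 2) * 0 ^ 2 + 2 * 1 ^ 2) with 2 in * by ring.
  replace ((INR n + 2) * 1 ^ 2 + 2 * 0 ^ 2) with (INR n + 2) in Hleft by ring.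
  replace ((INR n + 2) * (-1) ^ 2 + 2 * 0 ^ 2) with (INR n + 2) in Hright by ring.
  rewrite travel_time_0 in Hleft. rewrite ln_div by lra.
  replace ((ln (INR n + 2) - ln 2) / INR n) with
    (2 * (/ (2 * INR n) * (ln (INR n + 2) - ln 2))) by (field; lra).
  lra.
Qed.

(** The segment [0, PI] is cut at the points [PI/2 - e] and [PI/2 + e], with
    [e = 1 / sqrt n]. *)
Lemma travel_time_le (n : nat) :
  (1 <= n)%nat ->
  travel_time n PI <= ln (INR n) / INR n + (2 * ln 2 + 16) / INR n.
Proof.
  intros Hn. assert (HP := PI2_1).
  assert (Hn1 : 1 <= INR n) by (apply (le_INR 1); exact Hn).
  set (r := sqrt (INR n)).
  assert (Hr : r * r = INR n) by (apply sqrt_sqrt; lra).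
  assert (Hr1 : 1 <= r).
  { unfold r. rewrite <- sqrt_1. apply sqrt_le_1_alt. exact Hn1. }
  set (e := / r).
  assert (Her : e * r = 1) by (unfold e; field; lra).
  assert (He : 0 < e <= 1).
  { split; [apply Rinv_0_lt_compat; lra|].
    unfold e. rewrite <- Rinv_1. apply Rinv_le_contravar; lra. }
  assert (Hee : INR n * (e * e) = 1) by (rewrite <- Hr; unfold e; field; lra).
  assert (Hsin : e / 2 <= sin e) by (apply half_le_sin; lra).
  (* The two outer pieces, where the reciprocal is at most [sin / (n |cos|)]. *)
  assert (Hlog : - ln (sin e) <= ln (INR n) / 2 + ln 2).
  { assert (H : ln (e / 2) <= ln (sin e)) by (apply ln_le; lra).
    rewrite ln_div in H by lra. unfold e in H at 1. rewrite ln_Rinv in H by lra.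
    rewrite <- Hr, ln_mult by lra. lra. }
  assert (Hleft : travel_time n (PI / 2 - e) <= / INR n * - ln (sin e)).
  { assert (H : travel_time n (PI / 2 - e) - travel_time n 0 <=
      - / INR n * ln (cos (PI / 2 - e)) - - / INR n * ln (cos 0)).
    { apply (increment_le (travel_time n) (fun x => - / INR n * ln (cos x))
        (slowness_ext n) (fun x => sin x / (INR n * cos x))); [lra| | |].
      - intros x _. now apply is_derive_travel_time.
      - intros x Hx. assert (0 < cos x) by (apply cos_gt_0; lra).
        auto_derive; [lra|]. field. lra.
      - intros x Hx. rewrite slowness_ext_eq by lra.
        apply slowness_le_left; [assumption|lra]. }
    rewrite cos_shift, cos_0, ln_1, travel_time_0 in H. lra. }
  assert (Hcos : cos (PI / 2 + e) = - sin e).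
  { rewrite sin_cos. ring. }
  assert (Hright : travel_time n PI - travel_time n (PI / 2 + e)
                   <= / INR n * - ln (sin e)).
  { assert (H : travel_time n PI - travel_time n (PI / 2 + e) <=
      / INR n * ln (- cos PI) - / INR n * ln (- cos (PI / 2 + e))).
    { apply (increment_le (travel_time n) (fun x => / INR n * ln (- cos x))
        (slowness_ext n) (fun x => sin x / (INR n * - cos x))); [lra| | |].
      - intros x _. now apply is_derive_travel_time.
      - intros x Hx. assert (cos x < 0) by (apply cos_lt_0; lra).
        auto_derive; [lra|]. field. lra.
      - intros x Hx. rewrite slowness_ext_eq by lra.
        apply slowness_le_right; [assumption|lra]. }
    rewrite Hcos, cos_PI, Ropp_involutive in H.
    replace (- -1) with 1 in H by ring. rewrite ln_1 in H. lra. }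
  (* The window: by [sin_power_integral_upper] the integral up to [PI/2 - e] is
     at most [1 / (n sin e) <= 2 e], and crossing the window adds at most [2 e]. *)
  assert (HI : sin_power_integral n (PI / 2 + e) <= 4 * e).
  { assert (H1 : sin_power_integral n (PI / 2 - e) <= 2 * e).
    { assert (H := sin_power_integral_upper n (PI / 2 - e) ltac:(lra)).
      rewrite cos_shift in H.
      assert (H2 : sin (PI / 2 - e) ^ (n + 1) <= 1).
      { rewrite <- (pow1 (n + 1)). apply pow_incr.
        split; [apply sin_ge_0; lra|apply SIN_bound]. }
      assert (H3 := sin_power_integral_pos n (PI / 2 - e) ltac:(lra)).
      set (J := sin_power_integral n (PI / 2 - e)) in *.
      assert (H4 : INR n * (e / 2) * J <= 1).
      { eapply Rle_trans; [|exact (Rle_trans _ _ _ H H2)].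
        apply Rmult_le_compat_r; [lra|].
        apply Rmult_le_compat; lra. }
      apply (Rmult_le_compat_l (2 * e)) in H4; [|lra].
      replace (2 * e * (INR n * (e / 2) * J)) with (INR n * (e * e) * J) in H4
        by field.
      rewrite Hee in H4. lra. }
    assert (H2 : sin_power_integral n (PI / 2 + e) -
                 sin_power_integral n (PI / 2 - e) <= (PI / 2 + e) - (PI / 2 - e)).
    { apply (increment_le (sin_power_integral n) (fun x => x)
        (fun x => sin x ^ n) (fun _ => 1)); [lra| | |].
      - intros x _. apply is_derive_sin_power_integral.
      - intros x _. apply (is_derive_id x).
      - intros x Hx. rewrite <- (pow1 n). apply pow_incr.
        split; [apply sin_ge_0; lra|apply SIN_bound]. }
    lra. }
  assert (Hwin : travel_time n (PI / 2 + e) - travel_time n (PI / 2 - e)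
                 <= 8 * e * (PI / 2 + e) - 8 * e * (PI / 2 - e)).
  { apply (increment_le (travel_time n) (fun x => 8 * e * x)
      (slowness_ext n) (fun _ => 8 * e)); [lra| | |].
    - intros x _. now apply is_derive_travel_time.
    - intros x _. auto_derive; [exact I|]. ring.
    - intros x Hx. rewrite slowness_ext_eq by lra.
      (* [sin x = cos (PI/2 - x) >= 1 - e^2/2] and [n e^2 = 1]. *)
      assert (Hhalf : 1 / 2 <= sin x ^ n).
      { assert (Hb := bernoulli_inequality n (e * e / 2) ltac:(nra)).
        eapply Rle_trans; [|apply Rle_trans with (1 := Hb); apply pow_incr].
        - lra.
        - split; [nra|]. rewrite <- cos_shift.
          assert (Hc := one_minus_half_sqr_le_cos (PI / 2 - x)).
          nra. }
      eapply Rle_trans; [apply slowness_le_quotient; [assumption|lra]|].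
      assert (Hmono : sin_power_integral n x <= 4 * e).
      { eapply Rle_trans; [|exact HI].
        assert (H : 0 * (PI / 2 + e) - 0 * x <=
          sin_power_integral n (PI / 2 + e) - sin_power_integral n x); [|lra].
        apply (increment_le (fun u => 0 * u) (sin_power_integral n)
          (fun _ => 0) (fun u => sin u ^ n)); [lra| | |].
        - intros u _. auto_derive; [exact I|]. ring.
        - intros u _. apply is_derive_sin_power_integral.
        - intros u Hu. apply pow_le, sin_ge_0; lra. }
      replace (8 * e) with (4 * e / (1 / 2)) by field.
      apply Rdiv_le_cross; [lra|lra|].
      assert (H := sin_power_integral_pos n x ltac:(lra)).
      apply Rmult_le_compat; lra. }
  assert (Hinv : / INR n = e * e) by (rewrite <- Hr; unfold e; field; lra).
  assert (Hlog2 : / INR n * - ln (sin e) <= / INR n * (ln (INR n) / 2 + ln 2)).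
  { apply Rmult_le_compat_l; [|exact Hlog]. left; apply Rinv_0_lt_compat; lra. }
  unfold Rdiv at 1 2.
  replace (8 * e * (PI / 2 + e) - 8 * e * (PI / 2 - e)) with (16 * / INR n)
    in Hwin by (rewrite Hinv; ring).
  lra.
Qed.

Lemma is_lim_seq_inv_ln (c : R) :
  is_lim_seq (fun n => c / ln (INR n)) 0.
Proof.
  assert (H : is_lim_seq (fun n => ln (INR n)) p_infty).
  { apply (is_lim_comp_seq ln INR p_infty p_infty).
    - apply is_lim_ln_p.
    - now exists 0%nat.
    - apply is_lim_seq_INR. }
  replace (Finite 0) with (Rbar_mult c (Rbar_inv p_infty))
    by (simpl; f_equal; ring).
  apply is_lim_seq_scal_l. apply is_lim_seq_inv; [exact H|discriminate].
Qed.

Lemma travel_time_equivalent (T : nat -> R) :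
  (forall n, (1 <= n)%nat -> T n = travel_time n PI) ->
  seq_equivalent T (fun n => ln (INR n) / INR n).
Proof.
  intros HT. unfold seq_equivalent.
  apply (is_lim_seq_le_le_loc
    (fun n => 1 - ln 2 / ln (INR n)) _
    (fun n => 1 + (2 * ln 2 + 16) / ln (INR n))).
  - exists 2%nat. intros n Hn. rewrite HT by lia.
    assert (Hn2 : 2 <= INR n) by (apply (le_INR 2); exact Hn).
    assert (Hl2 := ln_lt_2). 
    assert (Hln : ln 2 <= ln (INR n)) by (apply ln_le; lra).
    assert (Hlo := travel_time_ge n ltac:(lia)).
    assert (Hup := travel_time_le n ltac:(lia)).
    assert (Hmono : ln (INR n) <= ln (INR n + 2)) by (apply ln_le; lra).
    rewrite ln_div in Hlo by lra.
    assert (Hpos : 0 < ln (INR n) / INR n) by (apply Rdiv_lt_0_compat; lra).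
    split; apply (Rmult_le_reg_r (ln (INR n) / INR n)); try exact Hpos;
      replace (travel_time n PI / (ln (INR n) / INR n) * (ln (INR n) / INR n))
        with (travel_time n PI) by (field; lra).
    + eapply Rle_trans; [|exact Hlo].
      replace ((1 - ln 2 / ln (INR n)) * (ln (INR n) / INR n)) with
        ((ln (INR n) - ln 2) / INR n) by (field; lra).
      apply Rmult_le_compat_r; [left; apply Rinv_0_lt_compat; lra|lra].
    + eapply Rle_trans; [exact Hup|]. right. field. lra.
  - replace (Finite 1) with (Finite (1 - 0)) by (f_equal; ring).
    apply is_lim_seq_minus'; [apply is_lim_seq_const|apply is_lim_seq_inv_ln].
  - replace (Finite 1) with (Finite (1 + 0)) by (f_equal; ring).
    apply is_lim_seq_plus'; [apply is_lim_seq_const|apply is_lim_seq_inv_ln].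
Qed.

Theorem theorem5 :
  (forall n : nat, (1 <= n)%nat -> exists! T : R, is_hitting_time n T) /\
  (forall T : nat -> R,
     (forall n : nat, (1 <= n)%nat -> is_hitting_time n (T n)) ->
     seq_equivalent T (fun n : nat => ln (INR n) / INR n)).
Proof.
  split.
  - intros n Hn. exists (travel_time n PI). split.
    + now apply hitting_time_travel_time.
    + intros T HT. symmetry. now apply hitting_time_eq.
  - intros T HT. apply travel_time_equivalent.
    intros n Hn. apply hitting_time_eq; auto.
Qed.
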